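(* Let $\alpha\in(0,1)$, $a<T$ and $y^*\in\mathbb{R}$, and let $f:[a,T]\times\mathbb{R}\to\mathbb{R}$ be continuous and bounded and satisfy a Lipschitz condition with respect to the second variable, i.e. there is $L\ge 0$ with $|f(t,u)-f(t,v)|\le L|u-v|$ for all $t\in[a,T]$ and $u,v\in\mathbb{R}$. Let $y$ be the solution on $[a,T]$ of the terminal value problem $$D_{*a}^{\alpha}y(t)=f(t,y(t)),\qquad y(T)=y^*,$$ and, for $\tilde a$ with $a\le\tilde a<T$, let $\tilde y$ be the solution on $[\tilde a,T]$ of the terminal value problem $$D_{*\tilde a}^{\alpha}\tilde y(t)=f(t,\tilde y(t)),\qquad \tilde y(T)=y^*.$$ Then $$\sup_{t\in[\tilde a,T]}|y(t)-\tilde y(t)| = O\bigl(|a-\tilde a|^{\alpha}\bigr),$$ i.e. there is a constant $C$, depending on $\alpha,a,T,f,y^*$ but not on $\tilde a$, such that $\sup_{t\in[\tilde a,T]}|y(t)-\tilde y(t)|\le C|a-\tilde a|^{\alpha}$ for all $\tilde a\in[a,T)$.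
   Context: For $\alpha\in(0,1)$ and a continuous function $y$ on $[b,T]$, the Caputo differential operator of order $\alpha$ with starting point $b$ is $$D_{*b}^{\alpha}y(t) = \frac{d}{dt}\,\frac{1}{\Gamma(1-\alpha)}\int_b^t (t-s)^{-\alpha}\,[y(s)-y(b)]\,ds.$$ A solution on $[b,T]$ of the terminal value problem $D_{*b}^{\alpha}y(t)=f(t,y(t))$, $y(T)=y^*$, is a continuous function $y$ on $[b,T]$ satisfying the differential equation on $(b,T]$ and the terminal condition $y(T)=y^*$. Existence and uniqueness of solutions to such terminal value problems is known from earlier literature. For continuous $f$, this problem is known to be equivalent, for continuous $y$, to the integral equation $y(t)=y^*+\frac{1}{\Gamma(\alpha)}\int_b^T G(t,s)f(s,y(s))\,ds$, $t\in[b,T]$, where $G(t,s)=-(T-s)^{\alpha-1}$ for $s>t$ and $G(t,s)=(t-s)^{\alpha-1}-(T-s)^{\alpha-1}$ for $s\le t$. *)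

(* Defs.v *)
From HB Require Import structures.
From mathcomp Require Import all_boot all_order all_algebra.
From mathcomp Require Import all_classical all_reals all_analysis.

Set Implicit Arguments.
Unset Strict Implicit.
Unset Printing Implicit Defensive.

Import Order.TTheory GRing.Theory Num.Theory.
Import numFieldNormedType.Exports.

Local Open Scope classical_set_scope.
Local Open Scope ring_scope.

(* Meaningful for 0 < x, where the integrand is Lebesgue integrable. *)
Definition Gamma (R : realType) (x : R) : R :=
  \int[lebesgue_measure]_(t in `]0, +oo[) (t `^ (x - 1) * expR (- t)).

(* Derivative relative to A: the difference quotient at t only sees points of
   A, so it is two-sided in the interior of A and one-sided at an endpoint. *)
Definition diff_quotient (R : realType) (g : R -> R) (t s : R) : R :=
  (g s - g t) / (s - t).

Definition derivable_within (R : realType) (A : set R) (g : R -> R) (t : R)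
  : Prop :=
  cvg (diff_quotient g t @ within A t^').

Definition derive_within (R : realType) (A : set R) (g : R -> R) (t : R) : R :=
  lim (diff_quotient g t @ within A t^').

(* For t = s the library convention is 0 `^ (- alpha) = 0; this only affects a
   null set of the domain of integration. *)
Definition caputo_primitive (R : realType) (alpha b : R) (y : R -> R) (t : R)
  : R :=
  (Gamma (1 - alpha))^-1 *
  \int[lebesgue_measure]_(s in `[b, t]) ((t - s) `^ (- alpha) * (y s - y b)).

(* y stands for a function on [b, T]: its values outside [b, T] are irrelevant,
   and the derivative at t = T is the left derivative. *)
Definition caputo_derivable (R : realType) (alpha b T : R) (y : R -> R) (t : R)
  : Prop :=
  derivable_within `[b, T] (caputo_primitive alpha b y) t.

Definition caputo (R : realType) (alpha b T : R) (y : R -> R) (t : R) : R :=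
  derive_within `[b, T] (caputo_primitive alpha b y) t.

Definition is_tvp_solution (R : realType) (alpha b T : R) (f : R * R -> R)
    (ystar : R) (y : R -> R) : Prop :=
  [/\ {within `[b, T], continuous y},
      (forall t, t \in `]b, T] ->
         caputo_derivable alpha b T y t /\ caputo alpha b T y t = f (t, y t))
    & y T = ystar].

(* Main.v *)
Require Import Defs.
From HB Require Import structures.
From mathcomp Require Import all_boot all_order all_algebra.
From mathcomp Require Import all_classical all_reals all_analysis.
From mathcomp Require Import measurable_realfun.
From mathcomp Require Import ring lra.
Import Order.TTheory GRing.Theory Num.Theory.
Import numFieldNormedType.Exports.
Local Open Scope classical_set_scope.
Local Open Scope ring_scope.

Set Implicit Arguments.
Unset Strict Implicit.
Unset Printing Implicit Defensive.

(** The two solutions start at different points, and the first step is to make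
the starting points disappear.  A solution on [b, T] is extended to the whole
line by the constants y b and y T.  The integrand of its Caputo primitive
vanishes before b, so that this primitive is, up to the factor
1 / Gamma (1 - alpha) and an additive constant, the convolution k * y of the
extension with the kernel k x = x^(- alpha) cut off at a fixed length H, the
same for every b.  For the difference z of the two extended solutions, the two
equations and the Lipschitz condition then say that on ]b, T[ the increments of
k * z are at most Gamma (1 - alpha) * L * sup |z| per unit of time
([memory_growth]).

Everything else is a consequence of one comparison principle ([comparison]):
if v is nonnegative up to a, and if k * v is nondecreasing for a while after
every point p < T at which v vanishes after having been nonnegative, then v is
nonnegative up to T.  Indeed the part of v before p contributes to k * v a
nonincreasing function of time, because k decreases, so the part of v after p
has a nondecreasing convolution with k; and a continuous function that is zero
before p and has a nondecreasing convolution with k is nonnegative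
([ge0_of_convol_nondecreasing]).  The last point is Abel's inversion:
x^(alpha - 1) and k convolve to a positive constant ([pker_sonine]), so that
convolving with x^(alpha - 1) turns k * u into a multiple of the primitive of
u, which is therefore nondecreasing.  Since this holds for every continuous u,
the oscillations that v may have just after p do no harm.

Three barriers are compared with the solutions.
- A ramp gives |y t - y a| <= 2 Gamma (1 - alpha) M h^alpha for t <= a + h,
  where M bounds |f|  ([solution_holder]).  With h = b - a, it follows that z
  stays within eps = O((b - a)^alpha) of the number y a - ytilde b as long as
  t <= b.
- A decaying exponential shows that |y a - ytilde b| <= eps
  ([initial_value_le]): otherwise z would stay above a positive multiple of
  that exponential, or below a negative one, and could not vanish at T.  This
  is a quantitative form of the fact that solutions with distinct initial
  values never meet, and the only use of the terminal condition.
- A growing exponential is a Gronwall estimate for the convolution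
  ([memory_growth_gronwall]): from |z| <= 2 eps up to b it deduces that |z| is
  at most a constant times eps up to T, the constant being independent of b. *)

(** * Affine changes of variable for the Lebesgue integral *)

Section AffineChangeOfVariable.
Context {R : realType}.
Local Notation mu := (@lebesgue_measure R).

Lemma measurable_affine (c d : R) : measurable_fun setT (fun x : R => c * x + d).
Proof. by apply: measurable_funD => //; exact: measurable_funM. Qed.

(** The image of the Lebesgue measure under an affine map, multiplied by |c|, has
the right value on every interval, and this determines it. *)
Lemma ge0_integral_affine (f : R -> \bar R) (c d : R) : c != 0 ->
  measurable_fun setT f -> (forall x, 0 <= f x)%E ->
  (\int[mu]_x f x = `|c|%:E * \int[mu]_x f (c * x + d)%R)%E.
Proof.
move=> c0 mf f0.
have k0 : 0 <= `|c| by [].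
have mlin : measurable_fun [set: measurableTypeR R]
    ((fun x : R => c * x + d) : measurableTypeR R -> measurableTypeR R).
  exact: measurable_affine.
pose pm := mscale (NngNum k0) (pushforward mu
  (fun x : R => c * x + d : measurableTypeR R))
  : {measure set (measurableTypeR R) -> \bar R}.
pose m := pm mlin.
have muE : forall X, ocitv X -> mu X = m X.
  move=> _ [[u v] _ <-] /=.
  rewrite /m /pm /mscale /= /pushforward.
  have [cpos|cneg|/eqP] := ltrgt0P c; last by rewrite (negbTE c0).
  - have -> : (fun x : R => c * x + d) @^-1` `]u, v] =
       `](u - d) / c, (v - d) / c]%classic.
      apply/seteqP; split => x /=;
        rewrite !in_itv /= ler_pdivlMr // ltr_pdivrMr //; lra.
    rewrite !lebesgue_measure_itv /= !lte_fin ltr_pM2r ?invr_gt0 // ltrD2r.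
    case: ifPn => _; last by rewrite mule0.
    rewrite -EFinB -EFinM; congr EFin; field.
    exact: c0.
  - have -> : (fun x : R => c * x + d) @^-1` `]u, v] =
       `[(v - d) / c, (u - d) / c[%classic.
      apply/seteqP; split => x /=;
        rewrite !in_itv /= ler_ndivrMr // ltr_ndivlMr //; lra.
    rewrite !lebesgue_measure_itv /= !lte_fin ltr_nM2r ?invr_lt0 // ltrD2r.
    case: ifPn => _; last by rewrite mule0.
    rewrite -EFinB -EFinM; congr EFin; field.
    exact: c0.
have muEE := lebesgue_measure_unique muE.
transitivity (\int[m]_x f x)%E.
  by apply: eq_measure_integral => A mA _; exact: muEE.
rewrite /m /pm ge0_integral_mscale //.
rewrite ge0_integral_pushforward //.
Qed.

Lemma integral_isometry (f : R -> \bar R) (c d : R) : `|c| = 1 ->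
  measurable_fun setT f -> (\int[mu]_x f x = \int[mu]_x f (c * x + d)%R)%E.
Proof.
move=> c1 mf.
have c0 : c != 0 by rewrite -normr_eq0 c1 oner_eq0.
rewrite integralE [RHS]integralE.
rewrite (@ge0_integral_affine (f ^\+)%E c d) //; last exact: measurable_funepos.
rewrite (@ge0_integral_affine (f ^\-)%E c d) //; last exact: measurable_funeneg.
by rewrite c1 !mul1e; congr (_ - _)%E; apply: eq_integral => x _;
  rewrite ?funeposE ?funenegE.
Qed.

Lemma Rintegral_isometry (f : R -> R) (c d : R) : `|c| = 1 ->
  measurable_fun setT f -> \int[mu]_x f x = \int[mu]_x f (c * x + d).
Proof.
move=> c1 mf; congr fine.
by rewrite (@integral_isometry (fun x => (f x)%:E) c d) //; exact/measurable_EFinP.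
Qed.

End AffineChangeOfVariable.

(** * The power kernel *)

Section PowerKernel.
Context {R : realType}.
Local Notation mu := (@lebesgue_measure R).
Implicit Types (beta H x : R).

(** The cut-off at H makes the kernel integrable on the line; beta = 0 gives the
indicator function of ]0, H]. *)
Definition pker beta H : R -> R := (fun x => x `^ (- beta)) \_ `]0, H].

Lemma pkerE beta H x : 0 < x <= H -> pker beta H x = x `^ (- beta).
Proof. by move=> xH; rewrite /pker patchE mem_set //= in_itv. Qed.

Lemma pker_out beta H x : ~~ (0 < x <= H) -> pker beta H x = 0.
Proof.
by move=> xH; rewrite /pker patchE memNset //= in_itv /=; exact/negP.
Qed.

Lemma pker_ge0 beta H x : 0 <= pker beta H x.
Proof. by apply: restrict_ge0 => {}x _; exact: powR_ge0. Qed.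

Lemma measurable_pker beta H : measurable_fun setT (pker beta H).
Proof.
apply/measurable_restrict => //; apply: measurable_funTS.
exact: measurable_powR.
Qed.

Lemma integral_powR_le (beta e H : R) : 0 < e -> e < H -> beta < 1 ->
  (\int[mu]_(x in `[e, H]) (x `^ (- beta))%:E <= (H `^ (1 - beta) / (1 - beta))%:E)%E.
Proof.
move=> e0 eH b1.
have b1' : 0 < 1 - beta by rewrite subr_gt0.
pose F := fun x : R => (1 - beta)^-1 * x `^ (1 - beta).
have dF x : 0 < x -> is_derive x 1 F (x `^ (- beta)).
  move=> x0; apply: is_derive_eq.
    exact: (@is_deriveZ _ _ _ _ (1 - beta)^-1 x 1 _ (is_derive1_powR (1 - beta) x0)).
  rewrite scalerA mulVf ?gt_eqF // scale1r; congr (_ `^ _); ring.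
have cF x : 0 < x -> F @ x --> F x.
  by move=> x0; apply/differentiable_continuous/derivable1_diffP; have [] := dF _ x0.
rewrite (@continuous_FTC2 _ _ F) //.
- rewrite -EFinB lee_fin /F mulrC [X in _ - X]mulrC gerBl mulr_ge0 ?powR_ge0 //.
  by rewrite invr_ge0 ltW.
- apply: continuous_in_subspaceT => x /[!inE] /=; rewrite in_itv /= => /andP[ex xH].
  have x0 : 0 < x by lra.
  apply/differentiable_continuous/derivable1_diffP.
  by apply: derivable_powR; rewrite in_itv /= x0.
- split.
  + by move=> x; rewrite in_itv /= => /andP[ex _]; have [] := dF x (lt_trans e0 ex).
  + by apply: cvg_at_right_filter; exact: cF.
  + by apply: cvg_at_left_filter; apply: cF; exact: lt_trans e0 eH.
- move=> x; rewrite in_itv /= => /andP[ex _].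
  by rewrite derive1E; have [_ ->] := dF x (lt_trans e0 ex).
Qed.

(** The singularity at 0 is approached by the intervals [H / (n + 2), H]. *)
Lemma integrable_pker beta H : beta < 1 -> 0 < H ->
  mu.-integrable setT (EFin \o pker beta H).
Proof.
move=> b1 H0.
pose F (n : nat) : set R := `[H / n.+2%:R, H]%classic.
have FE : \bigcup_n F n = `]0, H]%classic.
  apply/seteqP; split => x /=.
    move=> [n _]; rewrite /F /= !in_itv /= => /andP[h1 ->]; rewrite andbT.
    by apply: lt_le_trans h1; rewrite divr_gt0.
  rewrite in_itv /= => /andP[x0 xH].
  exists (Num.truncn (H / x)) => //; rewrite /F /= in_itv /= xH andbT.
  rewrite ler_pdivrMr // mulrC -ler_pdivrMr //.
  apply: le_trans (ltW (truncnS_gt _)) _.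
  by rewrite ler_nat.
have mf n : measurable_fun (F n) (fun x => (x `^ (- beta))%:E).
  by apply/measurable_EFinP; apply: measurable_funTS; exact: measurable_powR.
apply/integrableP; split; first by apply/measurable_EFinP; exact: measurable_pker.
have -> : (\int[mu]_x `|(EFin \o pker beta H) x| =
           \int[mu]_(x in `]0%R, H]) (x `^ (- beta))%:E)%E.
  rewrite [RHS]integral_mkcond; apply: eq_integral => x _.
  by rewrite /= ger0_norm ?pker_ge0 // /pker !patchE; case: ifP.
rewrite -FE.
have ndF : nondecreasing_seq F.
  move=> m n mn; rewrite subsetEset => x /=; rewrite /F /= !in_itv /= => /andP[h ->].
  rewrite andbT; apply: le_trans h; rewrite ler_pM2l // lef_pV2 ?posrE //.
  by rewrite ler_nat !ltnS.
have cv : (\int[mu]_(x in F i) (x `^ (- beta))%:E @[i --> \oo] -->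
    \int[mu]_(x in \bigcup_i F i) (x `^ (- beta))%:E)%E.
  apply: ge0_nondecreasing_set_cvg_integral => //.
  - by move=> i; exact: measurable_itv.
  - by move=> i x _; rewrite lee_fin powR_ge0.
rewrite -(cvg_lim _ cv) //.
apply: (@le_lt_trans _ _ (H `^ (1 - beta) / (1 - beta))%:E); last exact: ltry.
apply: lime_le; first exact: cvgP cv.
apply: nearW => n; apply: integral_powR_le => //.
  by rewrite divr_gt0.
by rewrite ltr_pdivrMr // ltr_pMr // ltr1n.
Qed.

Lemma powRN_anti beta x y : 0 <= beta -> 0 < x -> x <= y ->
  y `^ (- beta) <= x `^ (- beta).
Proof.
move=> b0 x0 xy; have y0 := lt_le_trans x0 xy.
rewrite !powRN lef_pV2 ?posrE ?powR_gt0 //.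
by apply: ge0_ler_powR => //; rewrite nnegrE ltW.
Qed.

Lemma pker_anti beta H x y : 0 <= beta -> 0 < x -> x <= y ->
  pker beta H y <= pker beta H x.
Proof.
move=> b0 x0 xy; have y0 := lt_le_trans x0 xy.
have [yH|yH] := leP y H; last first.
  by rewrite (@pker_out _ _ y) ?pker_ge0 // y0 leNgt yH.
by rewrite !pkerE ?powRN_anti //; apply/andP; split => //; exact: le_trans yH.
Qed.

Lemma pker_ge beta H x y : 0 <= beta -> 0 < x <= y -> y <= H ->
  y `^ (- beta) <= pker beta H x.
Proof.
move=> b0 /andP[x0 xy] yH.
by rewrite pkerE ?powRN_anti // x0 (le_trans xy).
Qed.

(** Gamma is a real-valued integral, hence 0 if the integral were infinite: its
positivity also requires the integrand to be integrable, which holds because it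
is below the kernel on ]0, 1] and below exp (- t) after 1. *)
Lemma Gamma_gt0 (alpha : R) : 0 < alpha -> alpha < 1 -> 0 < Gamma (1 - alpha).
Proof.
move=> a0 a1; rewrite /Gamma /Rintegral.
have -> : 1 - alpha - 1 = - alpha by ring.
pose g (t : R) := t `^ (- alpha) * expR (- t).
rewrite -/(g _).
have one_pow : (1 : R) `^ (- alpha) = 1 by rewrite powR1.
have mg : measurable_fun setT g.
  apply: measurable_funM; first exact: measurable_powR.
  by apply: measurableT_comp => //; exact: measurableT_comp.
have g0 t : 0 <= g t by rewrite mulr_ge0 ?powR_ge0 ?expR_ge0.
have fin : (\int[mu]_(x in `]0%R, +oo[) (g x)%:E < +oo)%E.
  pose D x := (pker alpha 1 x)%:E.
  pose E x := (exponential_pdf (1 : R) x)%:E.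
  apply: (@le_lt_trans _ _ (\int[mu]_x (D x + E x))%E).
    rewrite integral_mkcond; apply: ge0_le_integral => //.
    - by move=> x _; rewrite patchE; case: ifP => // _; rewrite lee_fin.
    - apply/(measurable_restrictT _ _).1 => //; apply: measurable_funTS.
      exact/measurable_EFinP.
    - apply: emeasurable_funD; apply/measurable_EFinP.
        exact: measurable_pker.
      exact: measurable_exponential_pdf.
    - move=> x _; rewrite /D /E -EFinD patchE; case: ifPn => [|_]; last first.
        by rewrite lee_fin addr_ge0 ?pker_ge0 ?exponential_pdf_ge0.
      rewrite inE /= in_itv /= andbT => x0; rewrite lee_fin.
      have e1 : expR (- x) <= 1 by rewrite expR_le1 oppr_le0 ltW.
      rewrite exponential_pdfE ?(ltW x0) // mul1r mulN1r.
      have [x1|x1] := leP x 1.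
        rewrite pkerE ?x0 // /g -[leLHS]addr0 lerD ?expR_ge0 //.
        by rewrite ler_piMr ?powR_ge0.
      rewrite /g pker_out ?add0r ?ler_piMl ?expR_ge0 //; last first.
        by rewrite leNgt x1 andbF.
      by rewrite -[leRHS]one_pow powRN_anti // ltW.
  have iD : mu.-integrable setT D by apply: integrable_pker.
  have iE : mu.-integrable setT E by apply: integrable_exponential_pdf.
  by rewrite integralD // lte_add_pinfty //; apply: integrable_lty.
rewrite fine_gt0 // fin andbT.
apply: (@lt_le_trans _ _ (\int[mu]_(x in `]0%R, 1%R]) (expR (-1))%:E)%E).
  rewrite integral_cst //= lebesgue_measure_itv /= lte_fin ltr01 oppr0 adde0 mule1.
  by rewrite lte_fin expR_gt0.
apply: (@le_trans _ _ (\int[mu]_(x in `]0%R, 1%R]) (g x)%:E)%E).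
  apply: ge0_le_integral => //.
  - by apply/measurable_EFinP; exact: measurable_funTS.
  - move=> x /=; rewrite in_itv /= => /andP[x0 x1]; rewrite lee_fin /g.
    rewrite -[leLHS]mul1r ler_pM ?expR_ge0 //.
      by rewrite -[leLHS]one_pow powRN_anti // ltW.
    by rewrite ler_expR lerN2.
apply: ge0_subset_integral => //.
- by apply/measurable_EFinP; exact: measurable_funTS.
- by move=> x _; rewrite lee_fin.
- by move=> x /=; rewrite !in_itv /= andbT => /andP[].
Qed.

End PowerKernel.

(** * The kernels of exponents alpha and 1 - alpha convolve to a constant *)

Section Sonine.
Context {R : realType}.
Local Notation mu := (@lebesgue_measure R).
Implicit Types (alpha beta H x s : R).

Lemma pker_scale beta H x s : 0 < s ->
  pker beta H (s * x) = s `^ (- beta) * pker beta (H / s) x.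
Proof.
move=> s0; have [/andP[x0 xH]|xH] := boolP (0 < x <= H / s).
  rewrite !pkerE ?x0 //; first by rewrite powRM // ltW.
  by rewrite mulr_gt0 //= mulrC -ler_pdivlMr.
by rewrite !pker_out ?mulr0 // pmulr_rgt0 // mulrC -ler_pdivlMr.
Qed.

(* The value B (alpha, 1 - alpha) of Euler's beta function. *)
Let B1 alpha := (\int[mu]_x (pker (1 - alpha) 1 x * pker alpha 1 (1 - x))%:E)%E.

Let measurable_prod alpha beta H s :
  measurable_fun setT (fun x : R => (pker beta H x * pker alpha H (s - x))%:E).
Proof.
apply/measurable_EFinP; apply: measurable_funM; first exact: measurable_pker.
apply: measurableT_comp; first exact: measurable_pker.
by apply: measurable_funB.
Qed.

(** At each point one of the two factors is evaluated at 1/2 or more, where it is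
at most 2; hence the integral is finite.  Both factors are at least 1. *)
Lemma beta_fin alpha : 0 < alpha -> alpha < 1 ->
  exists2 B : R, 1 <= B & B1 alpha = B%:E.
Proof.
move=> a0 a1; have b0 : 0 < 1 - alpha by lra.
have b1 : 1 - alpha < 1 by lra.
have half_pow beta : 0 < beta -> beta < 1 -> (2^-1 : R) `^ (- beta) <= 2.
  move=> be0 be1; rewrite powRN -[leRHS]invrK lef_pV2 ?posrE ?powR_gt0 ?invr_gt0 //.
  rewrite -[leLHS]powRr1 ?invr_ge0 //; apply: ger_powR; last exact: ltW.
  by rewrite invr_gt0 ltr0n invf_le1 // ler1n.
have pk2 beta x : 0 < beta -> beta < 1 -> 2^-1 <= x -> pker beta 1 x <= 2.
  move=> be0 be1 x2; apply: le_trans (half_pow _ be0 be1).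
  rewrite -(@pkerE _ beta 1 2^-1); last by rewrite invr_gt0 ltr0n invf_le1 // ler1n.
  by apply: pker_anti => //; exact: ltW.
have iE beta : 0 < beta -> beta < 1 -> (\int[mu]_x (2 * pker beta 1 x)%:E < +oo)%E.
  move=> be0 be1; apply: integrable_lty => //.
  under eq_fun do rewrite EFinM.
  by apply: integrableZl => //; apply: integrable_pker.
have fin : (B1 alpha < +oo)%E.
  apply: (@le_lt_trans _ _ (\int[mu]_x ((2 * pker (1 - alpha) 1 x)%:E +
     (2 * pker alpha 1 (-1 * x + 1))%:E))%E).
    apply: ge0_le_integral => //.
    - by move=> x _; rewrite lee_fin mulr_ge0 ?pker_ge0.
    - by apply: measurable_prod.
    - apply: emeasurable_funD; apply/measurable_EFinP; apply: measurable_funM => //.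
        exact: measurable_pker.
      apply: (measurableT_comp (measurable_pker _ _)).
      exact: measurable_affine.
    - move=> x _; rewrite -EFinD lee_fin mulN1r [X in 2 * pker alpha 1 X]addrC.
      have k0 := pker_ge0 (1 - alpha) 1 x.
      have l0 := pker_ge0 alpha 1 (1 - x).
      have [x2|x2] := leP 2^-1 x.
        have := pk2 _ _ b0 b1 x2; nra.
      have x2' : 2^-1 <= 1 - x by lra.
      have := pk2 _ _ a0 a1 x2'; nra.
  rewrite ge0_integralD //; last 4 first.
  - by move=> x _; rewrite lee_fin mulr_ge0 ?pker_ge0.
  - apply/measurable_EFinP; apply: measurable_funM => //; exact: measurable_pker.
  - by move=> x _; rewrite lee_fin mulr_ge0 ?pker_ge0.
  - apply/measurable_EFinP; apply: measurable_funM => //.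
    apply: (measurableT_comp (measurable_pker _ _)); exact: measurable_affine.
  rewrite -(@integral_isometry _ (fun x => (2 * pker alpha 1 x)%:E)) ?normrN1 //.
    by rewrite lte_add_pinfty ?iE.
  apply/measurable_EFinP; apply: measurable_funM => //; exact: measurable_pker.
have B0 : (0 <= B1 alpha)%E.
  by apply: integral_ge0 => x _; rewrite lee_fin mulr_ge0 ?pker_ge0.
have B1E : B1 alpha = (fine (B1 alpha))%:E by rewrite fineK // ge0_fin_numE.
exists (fine (B1 alpha)) => //.
rewrite -lee_fin -B1E.
apply: (@le_trans _ _ (\int[mu]_(x in `]0%R, 1%R[) 1)%E).
  rewrite integral_cst //= lebesgue_measure_itv /= lte_fin ltr01 mul1e.
  by rewrite oppr0 adde0.
rewrite integral_mkcond; apply: ge0_le_integral => //.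
- by move=> x _; rewrite patchE; case: ifP.
- exact/(measurable_restrictT _ _).1.
- exact: measurable_prod.
- move=> x _; rewrite patchE; case: ifPn => [|_]; last first.
    by rewrite lee_fin mulr_ge0 ?pker_ge0.
  rewrite inE /= in_itv /= => /andP[x0 x1]; rewrite lee_fin -[leLHS]mulr1.
  have pker1 beta z : 0 <= beta -> 0 < z <= 1 -> 1 <= pker beta 1 z.
    by move=> be0 z01; have := @pker_ge _ beta 1 z 1 be0 z01 (lexx 1); rewrite powR1.
  by rewrite ler_pM // pker1 //; lra.
Qed.

(** After the change of variable x := s * x, the powers of s compensate exactly
because the two exponents add up to 1. *)
Lemma pker_sonine alpha H : 0 < alpha -> alpha < 1 ->
  exists2 B : R, 1 <= B & forall s, 0 < s <= H ->
   (\int[mu]_x (pker (1 - alpha) H x * pker alpha H (s - x))%:E = B%:E)%E.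
Proof.
move=> a0 a1; have [B B1' BE] := beta_fin a0 a1; exists B => // s /andP[s0 sH].
rewrite (@ge0_integral_affine _ _ s 0) ?gt_eqF //; last first.
  by move=> x; rewrite lee_fin mulr_ge0 ?pker_ge0.
rewrite -ge0_integralZl //; last 2 first.
- exact: (measurableT_comp (measurable_prod alpha (1 - alpha) H s)
    (measurable_affine s 0)).
- by move=> x _; rewrite lee_fin mulr_ge0 ?pker_ge0.
rewrite -BE; apply: eq_integral => x _; rewrite -EFinM; congr EFin.
rewrite addr0 gtr0_norm // -{3}(mulr1 s) -mulrBr !pker_scale //.
transitivity (s * (s `^ (- (1 - alpha)) * s `^ (- alpha)) *
   (pker (1 - alpha) (H / s) x * pker alpha (H / s) (1 - x))); first by ring.
rewrite -powRD; last by rewrite (gt_eqF s0) implybT.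
rewrite -opprD subrK powR_inv1 ?(ltW s0) // divff ?gt_eqF // mul1r.
have Hs : 1 <= H / s by rewrite ler_pdivlMr // mul1r.
have [/andP[x0 x1]|x01] := boolP (0 < x < 1).
  by rewrite !pkerE //; lra.
have [x0|x0] := ltP 0 x; last by rewrite !(@pker_out _ _ _ x) ?mul0r // ltNge x0.
have x1 : 1 <= x by move: x01; rewrite x0 /= -leNgt.
by rewrite !(@pker_out _ _ _ (1 - x)) ?mulr0 // subr_gt0 ltNge x1.
Qed.

End Sonine.

(** * Convolution of the power kernel with a continuous function *)

Section Convolution.
Context {R : realType}.
Local Notation mu := (@lebesgue_measure R).
Variables (beta H : R).
Hypotheses (beta_ge0 : 0 <= beta) (beta_lt1 : beta < 1) (H_gt0 : 0 < H).
Implicit Types (u v : R -> R) (s t x c : R).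

Definition convol (k v : R -> R) t : R := \int[mu]_x (k x * v (t - x)).

Local Notation k := (pker beta H).

Lemma continuous_bounded_itv v (a b : R) : continuous v ->
  exists2 M, 0 <= M & forall s, a <= s <= b -> `|v s| <= M.
Proof.
move=> cv; have [ab|ba] := leP a b; last first.
  by exists 0 => // s /andP[h1 h2]; have := le_trans h1 h2; rewrite leNgt ba.
have cn : {within `[a, b], continuous (fun s => `|v s|)}.
  apply: continuous_subspaceT => s.
  by apply: continuous_comp; [exact: cv|exact: norm_continuous].
have [m mab Hm] := EVT_max ab cn.
by exists `|v m| => // s sab; apply: Hm; rewrite in_itv.
Qed.

Lemma measurable_flip v t : continuous v -> measurable_fun setT (fun x => v (t - x)).
Proof.
move=> cv; apply: (measurableT_comp (continuous_measurable_fun cv)).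
exact: measurable_funB.
Qed.

Lemma integrable_convol v t : continuous v ->
  mu.-integrable setT (fun x => (k x * v (t - x))%:E).
Proof.
move=> cv; have [M M0 HM] := continuous_bounded_itv (t - H) t cv.
have iM : mu.-integrable setT (fun x => (M%:E * (k x)%:E)%E).
  by apply: integrableZl => //; exact: integrable_pker.
apply: le_integrable iM => //.
  apply/measurable_EFinP; apply: measurable_funM; first exact: measurable_pker.
  exact: measurable_flip.
move=> x _; rewrite -EFinM !abse_EFin lee_fin !normrM mulrC.
rewrite (ger0_norm (pker_ge0 _ _ _)) (ger0_norm M0).
have [/andP[x0 xH]|xH] := boolP (0 < x <= H); last by rewrite pker_out ?mulr0.
by rewrite ler_wpM2r ?pker_ge0 // HM //; lra.
Qed.

Lemma convol_linear u v c t : continuous u -> continuous v ->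
  convol k (fun s => u s + c * v s) t = convol k u t + c * convol k v t.
Proof.
move=> cu cv; rewrite /convol -RintegralZl //; last exact: integrable_convol.
rewrite -RintegralD //; last 2 first.
- exact: integrable_convol.
- by apply: (integrableZl _ c) (integrable_convol t cv).
by apply: eq_Rintegral => x _; ring.
Qed.

Lemma convolZ v c t : continuous v ->
  convol k (fun s => c * v s) t = c * convol k v t.
Proof.
move=> cv; rewrite /convol -RintegralZl //; last exact: integrable_convol.
by apply: eq_Rintegral => x _; ring.
Qed.

Lemma convolN v t : continuous v -> convol k (fun s => - v s) t = - convol k v t.
Proof.
move=> cv; rewrite -mulN1r -convolZ //; congr (convol _ _ _).
by apply/funext => s; rewrite mulN1r.
Qed.

Lemma convolB u v t : continuous u -> continuous v ->
  convol k (fun s => u s - v s) t = convol k u t - convol k v t.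
Proof.
move=> cu cv; rewrite -[in RHS]mulN1r -convol_linear //; congr (convol _ _ _).
by apply/funext => s; rewrite mulN1r.
Qed.

Lemma convol0 v t : (forall x, 0 < x <= H -> v (t - x) = 0) -> convol k v t = 0.
Proof.
move=> v0; rewrite /convol (@eq_Rintegral _ _ _ _ _ (cst 0)) ?Rintegral_cst ?mul0r //.
move=> x _ /=; have [xH|xH] := boolP (0 < x <= H); last by rewrite pker_out ?mul0r.
by rewrite v0 ?mulr0.
Qed.

(** The kernel is at least d^(- beta) on ]0, d], an interval of length d. *)
Lemma convol_ge v t c d : continuous v -> 0 < d <= H -> 0 <= c ->
  (forall x, 0 < x <= H -> 0 <= v (t - x)) ->
  (forall x, 0 < x <= d -> c <= v (t - x)) ->
  c * d `^ (1 - beta) <= convol k v t.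
Proof.
move=> cv /andP[d0 dH] c0 v0 vc.
have -> : c * d `^ (1 - beta) = \int[mu]_(x in `]0, d]) (c * d `^ (- beta)).
  rewrite Rintegral_cst //= lebesgue_measure_itv /= lte_fin d0 -EFinB subr0 /=.
  by rewrite addrC powRD ?(gt_eqF d0) ?implybT // powRr1 ?ltW //; ring.
rewrite Rintegral_mkcond; apply: le_Rintegral => //.
- have -> : EFin \o ((fun=> c * d `^ (- beta)) \_ `]0, d]) =
    (fun x => (c * d `^ (- beta))%:E * (pker 0 d x)%:E)%E :> (R -> \bar R).
    apply/funext => x /=; rewrite /pker !patchE -EFinM.
    by case: ifP => _; rewrite ?oppr0 ?powRr0 ?mulr1 ?mulr0.
  by apply: integrableZl => //; apply: integrable_pker.
- exact: integrable_convol.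
- move=> x _; rewrite patchE; case: ifPn => [|_].
    rewrite inE /= in_itv /= => /andP[x0 xd]; rewrite mulrC ler_pM ?powR_ge0 //.
      by apply: pker_ge => //; rewrite x0.
    by apply: vc; rewrite x0.
  have [xH|xH] := boolP (0 < x <= H); last by rewrite pker_out ?mul0r.
  by rewrite mulr_ge0 ?pker_ge0 ?v0.
Qed.

End Convolution.

(** * Abel's inversion *)

Section AbelInversion.
Context {R : realType}.
Local Notation mu := (@lebesgue_measure R).
Variables (alpha H : R).
Hypotheses (a0 : 0 < alpha) (a1 : alpha < 1) (H0 : 0 < H).
Implicit Types (u v : R -> R) (s t x c p q : R).

Local Notation k := (pker alpha H).
Local Notation l := (pker (1 - alpha) H).

(** Fubini's theorem and [pker_sonine]: convolving k * u with the conjugate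
kernel gives B times the integral of u over the window [t - H, t].  Since u is
zero before p and t <= p + H, that integral is the primitive of u, and the
cut-offs of the kernels are not felt. *)
Lemma convol_sonine : exists2 B : R, 1 <= B & forall u p t,
  continuous u -> (forall s, s <= p -> u s = 0) -> t <= p + H ->
  mu.-integrable setT (fun x => (l x * convol k u (t - x))%:E) /\
  \int[mu]_x (l x * convol k u (t - x)) = B * convol (pker 0 H) u t.
Proof.
have b1 : 1 - alpha < 1 by rewrite ltrBlDr ltrDl.
have [B B1 HB] := pker_sonine H a0 a1; exists B => // u p t cu u0 tp.
pose F (z : R * R) : \bar R := (l z.1 * k (z.2 - z.1) * u (t - z.2))%:E.
have mF : measurable_fun setT F.
  apply/measurable_EFinP; apply: measurable_funM; first apply: measurable_funM.
  - exact: (measurableT_comp (measurable_pker _ _) measurable_fst).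
  - apply: (measurableT_comp (measurable_pker _ _)).
    by apply: measurable_funB; [exact: measurable_snd|exact: measurable_fst].
  - exact: (measurableT_comp (measurable_flip t cu) measurable_snd).
have ilk s : 0 < s <= H -> mu.-integrable setT (fun x => (l x * k (s - x))%:E).
  move=> sH; apply/integrableP; split.
    apply/measurable_EFinP; apply: measurable_funM; first exact: measurable_pker.
    apply: (measurableT_comp (measurable_pker _ _)); exact: measurable_funB.
  under eq_integral do rewrite gee0_abs ?lee_fin ?mulr_ge0 ?pker_ge0 //.
  by rewrite HB // ltry.
(* The condition on r covers both r = u (t - s) and its absolute value; it is
   what allows s > H, where the kernels no longer convolve to B. *)
have inner r s : (u (t - s) = 0 -> r = 0) ->
    (\int[mu]_x (l x * k (s - x) * r)%:E = (B * (pker 0 H s * r))%:E)%E.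
  move=> rs; have [sH|sH] := boolP (0 < s <= H); last first.
    rewrite (pker_out _ sH) mul0r mulr0; apply: integral0_eq => x _; congr EFin.
    have [x0|x0] := ltP 0 x; last by rewrite pker_out ?mul0r // ltNge x0.
    have [s0|s0] := ltP 0 s; last first.
      rewrite [X in _ * X * _]pker_out ?mulr0 ?mul0r //.
      by apply/negP => /andP[h _]; lra.
    move: sH; rewrite s0 /= -ltNge => sH; rewrite rs ?mulr0 // u0 //; lra.
  rewrite (pkerE _ sH) oppr0 powRr0 mul1r EFinM -(HB _ sH).
  under eq_integral do rewrite EFinM.
  by rewrite integralZr //; exact: ilk.
have iF : (mu \x mu)%E.-integrable setT F.
  apply/(integrable21ltyP mu mu mF).2.
  have -> : (fun y => \int[mu]_x `|F (x, y)|)%E =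
      (fun y => B%:E * `|(pker 0 H y * u (t - y))%:E|)%E.
    apply/funext => y; rewrite abse_EFin normrM (ger0_norm (pker_ge0 _ _ _)) -EFinM.
    rewrite -inner; last by move=> ->; rewrite normr0.
    apply: eq_integral => x _; rewrite /F /= !normrM.
    by rewrite !(ger0_norm (pker_ge0 _ _ _)).
  have := integrable_convol (ltr01 : (0 : R) < 1) H0 t cu.
  move=> /integrableP[mf fy].
  have Bge0 : 0 <= B by rewrite (le_trans _ B1).
  rewrite ge0_integralZl //; last by apply: measurableT_comp => //; exact: mf.
  by rewrite lte_mul_pinfty.
have FE x : (\int[mu]_y F (x, y) = (l x * convol k u (t - x))%:E)%E.
  rewrite (@integral_isometry _ _ 1 x) ?normr1 //; last exact: measurableT_comp.
  have iku := integrable_convol a1 H0 (t - x) cu.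
  rewrite EFinM /convol /Rintegral fineK; last exact: integrable_fin_num.
  rewrite -integralZl //; apply: eq_integral => y _; rewrite /F /= -EFinM.
  rewrite mul1r addrK -mulrA; congr (_ * (_ * u _))%:E; lra.
split.
  have := integrable_fubini_F iF.
  by apply: eq_integrable => // x _; rewrite /fubini_F FE.
rewrite /Rintegral.
under eq_integral do rewrite -FE.
rewrite (Fubini iF).
have FG y : (\int[mu]_x F (x, y) = (B * (pker 0 H y * u (t - y)))%:E)%E.
  by rewrite -(@inner (u (t - y))).
under eq_integral do rewrite FG.
have ik := integrable_convol (ltr01 : (0 : R) < 1) H0 t cu.
under eq_integral do rewrite EFinM.
by rewrite integralZl // fineM //; exact: integrable_fin_num.
Qed.

End AbelInversion.

(** * The comparison principle *)

Section Comparison.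
Context {R : realType}.
Variables (alpha H : R).
Hypotheses (a0 : 0 < alpha) (a1 : alpha < 1) (H0 : 0 < H).
Implicit Types (u v : R -> R) (s t x c p q h : R).

Local Notation k := (pker alpha H).

(** Both sides are integrals of u up to time t, in the form of convolutions with
indicator functions; the first is cut at t - h. *)
Lemma window_split u p t h : continuous u -> (forall s, s <= p -> u s = 0) ->
  t <= p + H -> 0 < h <= H ->
  convol (pker 0 H) u t = convol (pker 0 H) u (t - h) + convol (pker 0 h) u t.
Proof.
move=> cu u0 tp /andP[hgt0 hH].
have i1 := integrable_convol (ltr01 : (0 : R) < 1) H0 t cu.
have i2 := integrable_convol (ltr01 : (0 : R) < 1) hgt0 t cu.
apply/eqP; rewrite -subr_eq; apply/eqP.
rewrite /convol -RintegralB //.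
rewrite [RHS](@Rintegral_isometry _ _ 1 (- h)) ?normr1 //; last first.
  by apply: measurable_funM; [exact: measurable_pker|exact: measurable_flip].
apply: eq_Rintegral => x _.
have -> : t - h - (1 * x - h) = t - x by ring.
rewrite -mulrBl mul1r.
have [tx|tx] := leP (t - x) p; first by rewrite u0 ?mulr0.
have xH : x <= H by lra.
congr (_ * _).
have pk (h' y : R) : 0 < y <= h' -> pker 0 h' y = 1.
  by move=> yh; rewrite pkerE // oppr0 powRr0.
have [x0|x0] := ltP 0 x; last first.
  rewrite !pker_out ?subrr //; apply/negP => /andP[]; lra.
rewrite (pk H x) ?x0 //.
have [xh|xh] := leP x h.
  rewrite pk ?x0 // subrr pker_out //; apply/negP => /andP[]; lra.
rewrite [X in 1 - X]pker_out ?subr0; last by rewrite negb_and -ltNge xh orbT.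
by rewrite pk //; lra.
Qed.

(** By [convol_sonine] the primitive of u is the convolution of k * u with a
nonnegative kernel, so it is nondecreasing up to q like k * u itself.  If u
were negative at t, it would decrease just before t. *)
Lemma ge0_of_convol_nondecreasing u p q : continuous u ->
  (forall s, s <= p -> u s = 0) -> q <= p + H ->
  (forall s t, p <= s -> s <= t -> t <= q -> convol k u s <= convol k u t) ->
  forall t, p <= t <= q -> 0 <= u t.
Proof.
move=> cu u0 qp nd.
have N0 s : s <= p -> convol k u s = 0.
  by move=> sp; apply: convol0 => x /andP[x0 _]; apply: u0; lra.
have nd' s t : s <= t -> t <= q -> convol k u s <= convol k u t.
  move=> st tq; have [ps|sp] := leP p s; first exact: nd.
  rewrite (N0 s (ltW sp)); have [pt|tp] := leP p t; last by rewrite N0 // ltW.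
  by rewrite -(N0 p (lexx p)) nd.
have [B B1 HB] := convol_sonine a0 a1 H0.
have U s t : s <= t -> t <= q -> convol (pker 0 H) u s <= convol (pker 0 H) u t.
  move=> st tq; have B0 : 0 < B by exact: lt_le_trans B1.
  have tp : t <= p + H by exact: le_trans qp.
  have [is_ sE] := HB u p s cu u0 (le_trans st tp).
  have [it tE] := HB u p t cu u0 tp.
  rewrite -(ler_pM2l B0) -sE -tE; apply: le_Rintegral => //.
  move=> x _; have [x0|x0] := ltP 0 x; last by rewrite pker_out ?mul0r // ltNge x0.
  by rewrite ler_wpM2l ?pker_ge0 // nd'; lra.
move=> t /andP[pt tq]; rewrite leNgt; apply/negP => ut.
have ptl : p < t.
  by rewrite lt_neqAle pt andbT; apply/eqP => pE; rewrite -pE u0 ?ltxx in ut.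
have : \forall s \near t, u s < u t / 2.
  by apply: cvgr_lt (cu t) _ _; lra.
move=> /nbhs_ballP[e /= e0 He].
pose h := Num.min (e / 2) H.
have h0 : 0 < h by rewrite lt_min H0 divr_gt0.
have hH : h <= H by rewrite ge_min lexx orbT.
have he : h < e by rewrite gt_min ltr_pdivrMr // ltr_pMr // ltr1n.
have split := window_split cu u0 (le_trans tq qp) (introT andP (conj h0 hH)).
have := U (t - h) t; rewrite split lerDl gerBl => /(_ (ltW h0) tq).
apply/negP; rewrite -ltNge.
have cuN : continuous (fun s => - u s) by move=> s; apply: cvgN; exact: cu.
have : - (u t / 2) * h `^ (1 - 0) <= convol (pker 0 h) (fun s => - u s) t.
  apply: convol_ge => //; first by rewrite h0 lexx.
  - by lra.
  - move=> x /andP[x0 xh]; rewrite oppr_ge0; apply: le_trans (ltW (He _ _)) _; last by lra.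
    by rewrite /= /ball /= opprB addrC subrK ger0_norm; lra.
  - move=> x /andP[x0 xh]; rewrite lerN2; apply: (ltW (He _ _)).
    by rewrite /= /ball /= opprB addrC subrK ger0_norm; lra.
rewrite (convolN ltr01 h0) //.
rewrite subr0 powRr1 ?(ltW h0) // => hC.
have uh : u t * h < 0 by rewrite pmulr_llt0.
lra.
Qed.

(** A nonnegative past fades: as time passes, each past value is weighted by the
decreasing kernel at a greater age. *)
Lemma convol_past_anti v p s t : continuous v -> (forall r, 0 <= v r) ->
  (forall r, p <= r -> v r = 0) -> p <= s -> s <= t ->
  convol k v t <= convol k v s.
Proof.
move=> cv v0 vp ps st; pose h := t - s.
have is_ := integrable_convol a1 H0 s cv.
have mk (r : R) : measurable_fun setT (fun x => k (1 * x + r)).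
  exact: (measurableT_comp (measurable_pker alpha H) (measurable_affine 1 r)).
rewrite [leLHS](@Rintegral_isometry _ _ 1 h) ?normr1 //; last first.
  by apply: measurable_funM; [exact: measurable_pker|exact: measurable_flip].
have le (x : R) : k (1 * x + h) * v (t - (1 * x + h)) <= k x * v (s - x).
  have -> : t - (1 * x + h) = s - x by rewrite /h; ring.
  have [x0|x0] := ltP 0 x; last by rewrite vp ?mulr0 //; lra.
  by rewrite mul1r ler_wpM2r // pker_anti // ?(ltW a0) // lerDl subr_ge0.
apply: le_Rintegral => //.
apply: (le_integrable measurableT _ _ is_) => //.
  apply/measurable_EFinP; apply: measurable_funM; first exact: mk.
  apply: (measurableT_comp (continuous_measurable_fun cv)).
  by apply: measurable_funB => //; exact: measurable_affine.
move=> x _; rewrite !abse_EFin lee_fin !ger0_norm ?mulr_ge0 ?pker_ge0 //.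
Qed.

(** The proof looks at the infimum p of the points where v is negative, and splits
v at p, where it vanishes.  The part before p has a nonincreasing convolution by
[convol_past_anti], so the part after p has a nondecreasing one, and
[ge0_of_convol_nondecreasing] contradicts the choice of p. *)
Theorem comparison v a T : continuous v -> (forall s, s <= a -> 0 <= v s) ->
  (forall p, a <= p < T -> v p = 0 -> (forall s, s <= p -> 0 <= v s) ->
    exists2 d, 0 < d & forall s t, p <= s -> s <= t -> t <= p + d ->
      convol k v s <= convol k v t) ->
  forall t, t <= T -> 0 <= v t.
Proof.
move=> cv va loc t1 t1T; rewrite leNgt; apply/negP => vt1.
pose E := [set s | v s < 0].
have lbE : lbound E a.
  move=> s Es; rewrite leNgt; apply/negP => sa.
  by have := va s (ltW sa); rewrite leNgt Es.
have hE : has_inf E by split; [exists t1|exists a].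
pose p := inf E.
have ap : a <= p by apply: lb_le_inf => //; exists t1.
have pt1 : p <= t1 by apply: ge_inf => //; exists a.
have v_lt s : s < p -> 0 <= v s.
  move=> sp; rewrite leNgt; apply/negP => vs.
  have : p <= s by apply: ge_inf => //; exists a.
  by rewrite leNgt sp.
have near_p e : 0 < e -> exists2 s, v s < 0 & p <= s < p + e.
  move=> e0; have [s Es sp] := inf_adherent e0 hE.
  by exists s => //; rewrite sp andbT; apply: ge_inf => //; exists a.
have vp0 : 0 <= v p.
  rewrite leNgt; apply/negP => vp.
  have /nbhs_ballP[e /= e0 He] : \forall s \near p, v s < 0.
    exact: cvgr_lt (cv p) _ vp.
  have := He (p - e / 2); rewrite /ball /= opprB addrC subrK.
  rewrite gtr0_norm ?divr_gt0 // => /(_ ltac:(lra)).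
  by apply/negP; rewrite -leNgt; apply: v_lt; lra.
have v_le s : s <= p -> 0 <= v s.
  by rewrite le_eqVlt => /predU1P[->//|]; exact: v_lt.
have vpE : v p = 0.
  apply/eqP; rewrite eq_le vp0 andbT leNgt; apply/negP => vp.
  have /nbhs_ballP[e /= e0 He] : \forall s \near p, 0 < v s.
    exact: cvgr_gt (cv p) _ vp.
  have [s vs /andP[ps spe]] := near_p e e0.
  have := He s; rewrite /ball /= distrC ger0_norm ?subr_ge0 // => /(_ ltac:(lra)).
  by rewrite ltNge (ltW vs).
have pT : p < T.
  rewrite (lt_le_trans _ t1T) // lt_neqAle pt1 andbT.
  by apply/eqP => pE; move: vt1; rewrite -pE vpE ltxx.
have [d d0 nd] := loc p (introT andP (conj ap pT)) vpE v_le.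
pose e := Num.min d H.
have e0 : 0 < e by rewrite lt_min d0.
have eH : e <= H by rewrite ge_min lexx orbT.
have ed : e <= d by rewrite ge_min lexx.
pose v1 s := v (Num.min s p); pose v2 s := v (Num.max s p).
have cv1 : continuous v1.
  move=> s; apply: continuous_comp; last exact: cv.
  by apply: continuous_min; [exact: cvg_id|exact: cvg_cst].
have cv2 : continuous v2.
  move=> s; apply: continuous_comp; last exact: cv.
  by apply: continuous_max; [exact: cvg_id|exact: cvg_cst].
have vE : v = (fun s => v1 s + 1 * v2 s).
  apply/funext => s; rewrite /v1 /v2 mul1r; case: (leP s p) => sp.
    by rewrite vpE addr0.
  by rewrite vpE add0r.
have convE t : convol k v t = convol k v1 t + convol k v2 t.
  by rewrite {1}vE (convol_linear a1 H0) // mul1r.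
have v2_ge0 := @ge0_of_convol_nondecreasing v2 p (p + e) cv2.
have [s vs /andP[ps spe]] := near_p e e0.
have : 0 <= v2 s.
  apply: v2_ge0.
  - by move=> r rp; rewrite /v2 max_r.
  - by rewrite lerD2l.
  - move=> r t pr rt te.
    have c1 := @convol_past_anti v1 p r t cv1 _ _ pr rt.
    have := nd r t pr rt (le_trans te _); rewrite !convE lerD2l => /(_ ed).
    suff : convol k v1 t <= convol k v1 r by lra.
    apply: c1 => r'; first by apply: v_le; rewrite ge_min lexx orbT.
    by move=> pr'; rewrite /v1 min_r.
  - by rewrite ps ltW.
by rewrite /v2 max_l // leNgt vs.
Qed.

End Comparison.

(** * The Caputo primitive as a convolution *)

Section Caputo.
Context {R : realType}.
Local Notation mu := (@lebesgue_measure R).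
Variables (alpha H : R).
Hypotheses (a0 : 0 < alpha) (a1 : alpha < 1) (H0 : 0 < H).
Implicit Types (y g : R -> R) (b T s t x c : R).

Local Notation k := (pker alpha H).

Definition clamp b T y s := y (Num.min (Num.max s b) T).

Lemma clamp_in b T y s : b <= s <= T -> clamp b T y s = y s.
Proof. by move=> /andP[bs sT]; rewrite /clamp max_l // min_l. Qed.

Lemma clamp_le b T y s : b <= T -> s <= b -> clamp b T y s = y b.
Proof. by move=> bT sb; rewrite /clamp max_r // min_l. Qed.

Lemma continuous_clamp b T y : b < T -> {within `[b, T], continuous y} ->
  continuous (clamp b T y).
Proof.
move=> bT /subspace_continuousP cy s.
pose proj r := Num.min (Num.max r b) T.
have projP r : `[b, T]%classic (proj r).
  by rewrite /= in_itv /= /proj le_min le_max lexx orbT ltW // ge_min lexx orbT.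
have cproj : {for s, continuous proj}.
  apply: (@continuous_min _ _ (fun r => Num.max r b) (cst T)); last exact: cvg_cst.
  by apply: (@continuous_max _ _ id (cst b)); [exact: cvg_id|exact: cvg_cst].
move=> U /(cy _ (projP s)) WU.
have W : \forall r \near s, `[b, T]%classic (proj r) -> U (y (proj r)).
  exact: cproj _ WU.
suff : \forall r \near s, U (y (proj r)) by [].
by apply: filterS W => r; apply; exact: projP.
Qed.

(** The contribution of the times before b vanishes because the extension is
constant there, and the singular endpoint s = t because both conventions give
0. *)
Lemma caputo_primitive_convol b T y t : b < T -> T - b <= H ->
  {within `[b, T], continuous y} -> b <= t <= T ->
  caputo_primitive alpha b y t = (Gamma (1 - alpha))^-1 *
   (convol k (clamp b T y) t - y b * \int[mu]_x k x).
Proof.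
move=> bT TbH cy /andP[bt tT]; have cw := continuous_clamp bT cy.
have iw := integrable_convol a1 H0 t cw.
congr (_ * _).
transitivity (\int[mu]_x (k x * (clamp b T y (t - x) - y b))).
  rewrite [RHS](@Rintegral_isometry _ _ (-1) t) ?normrN1 //; last first.
    apply: measurable_funM; first exact: measurable_pker.
    apply: measurable_funB => //; exact: measurable_flip.
  rewrite Rintegral_mkcond; apply: eq_Rintegral => x _; rewrite patchE.
  have -> : t - (-1 * x + t) = x by ring.
  have -> : -1 * x + t = t - x by ring.
  case: ifPn => [|xbt].
    rewrite inE /= in_itv /= => /andP[bx xt].
    rewrite clamp_in ?bx ?(le_trans xt) //.
    have [->|xt'] := eqVneq x t.
      by rewrite subrr powR0 ?mul0r ?oppr_eq0 ?gt_eqF // pker_out ?mul0r // ltxx.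
    rewrite pkerE // subr_gt0 lt_neqAle xt' xt /=; lra.
  have [xb|xb] := leP x b; first by rewrite clamp_le ?subrr ?mulr0 // ltW.
  rewrite pker_out ?mul0r //; apply/negP => /andP[x1 x2].
  by move/negP: xbt; apply; rewrite inE /= in_itv /=; apply/andP; split; lra.
have ik := integrable_pker a1 H0.
rewrite /convol -RintegralZl // -RintegralB //.
  by apply: eq_Rintegral => x _; ring.
by apply: (integrableZl _ (y b)) ik.
Qed.

Lemma derive_within_interior b T g t : b < t < T ->
  derivable_within `[b, T] g t ->
  is_derive t 1 g (derive_within `[b, T] g t).
Proof.
move=> /andP[bt tT] dg.
have dq : diff_quotient g t @ t^' --> derive_within `[b, T] g t.
  move=> U /dg; rewrite /nbhs /= /fmap /= => WU.
  have WU' : \forall s \near t^', s \in `[b, T] -> U (diff_quotient g t s) by [].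
  have nA : \forall s \near t^', s \in `[b, T].
    apply: nbhs_dnbhs; near=> s; rewrite in_itv /=; apply/andP; split.
      by rewrite ltW //; near: s; exact: lt_nbhsr.
    by rewrite ltW //; near: s; exact: lt_nbhsl.
  by near=> s; apply: (near WU' s); [|near: s].
have cv : (fun h => h^-1 *: ((g \o shift t) (h *: 1) - g t)) @ 0^' -->
    derive_within `[b, T] g t.
  move=> U /dq; rewrite /nbhs /= /fmap /= /dnbhs /within /= => /nbhs_ballP[e /= e0 He].
  apply/nbhs_ballP; exists e => //= h he h0.
  have := He (h + t); rewrite /ball /= in he *.
  rewrite /diff_quotient addrK opprD addrCA subrr addr0 normrN => /(_ _ _).
  rewrite sub0r normrN in he => /(_ he).
  rewrite scaler1 /= /GRing.scale /= mulrC; apply.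
  by apply/eqP => ht; move/eqP: h0; apply; lra.
split; first exact: cvgP cv.
exact: cvg_lim cv.
Unshelve. all: by end_near. Qed.

Lemma increment_le g (dg : R -> R) s t c : s <= t ->
  (forall r, s <= r <= t -> is_derive r 1 g (dg r)) ->
  (forall r, s <= r <= t -> `|dg r| <= c) -> `|g t - g s| <= c * (t - s).
Proof.
move=> st dgE dgc.
have cg : {within `[s, t], continuous g}.
  apply: continuous_in_subspaceT => r /[!inE] /=; rewrite in_itv /= => rst.
  by apply/differentiable_continuous/derivable1_diffP; have [] := dgE _ rst.
have [r|r rst ->] := @MVT_segment _ g dg s t st _ cg.
  by rewrite in_itv /= => /andP[h1 h2]; apply: dgE; rewrite !ltW.
rewrite normrM [X in _ * X <= _]ger0_norm ?subr_ge0 // ler_wpM2r ?subr_ge0 //.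
by apply: dgc; move: rst; rewrite in_itv.
Qed.

End Caputo.

(** * Barriers *)

Section Barriers.
Context {R : realType}.
Variables (alpha H : R).
Hypotheses (a0 : 0 < alpha) (a1 : alpha < 1) (H0 : 0 < H).
Implicit Types (u v z phi : R -> R) (a b T s t x c d h m gap eps delta : R).

Local Notation k := (pker alpha H).

(** By [convol_ge] applied to the difference of v and its translate. *)
Lemma convol_increment_ge v s t c d : continuous v -> s <= t ->
  (forall x y, x <= y -> v x <= v y) -> 0 < d <= H -> 0 <= c ->
  (forall x, 0 < x <= d -> c <= v (t - x) - v (s - x)) ->
  c * d `^ (1 - alpha) <= convol k v t - convol k v s.
Proof.
move=> cv st ndv dH c0 vc.
have ctv : continuous (fun r => v (r + (t - s))).
  move=> r; apply: continuous_comp; last exact: cv.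
  by apply: cvgD; [exact: cvg_id|exact: cvg_cst].
have -> : convol k v t - convol k v s =
    convol k (fun r => v (r + (t - s)) - v r) s.
  rewrite (convolB a1 H0) //; congr (_ - _).
  rewrite /convol; apply: eq_Rintegral => x _; congr (_ * v _); ring.
apply: convol_ge => //.
- exact: ltW.
- by move=> r; apply: cvgB; [exact: ctv|exact: cv].
- by move=> x _; rewrite subr_ge0 ndv //; lra.
- move=> x xd; have -> : s - x + (t - s) = t - x by ring.
  exact: vc.
Qed.

Definition ramp a s : R := Num.max (s - a) 0.

Lemma continuous_ramp a : continuous (ramp a).
Proof.
move=> s; apply: (@continuous_max _ _ (fun r => r - a) (cst 0)); last exact: cvg_cst.
by apply: cvgB; [exact: cvg_id|exact: cvg_cst].
Qed.

Lemma ramp_homo a s t : s <= t -> ramp a s <= ramp a t.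
Proof. by move=> st; rewrite /ramp ge_max !le_max lerD2r st lexx orbT. Qed.

Lemma ramp_ge0 a s : 0 <= ramp a s.
Proof. by rewrite /ramp le_max lexx orbT. Qed.

Lemma rampE a s : a <= s -> ramp a s = s - a.
Proof. by move=> sa; rewrite /ramp max_l // subr_ge0. Qed.

Lemma ramp_le a s : s <= a -> ramp a s = 0.
Proof. by move=> sa; rewrite /ramp max_r // subr_le0. Qed.

(** Over the last h units of time before s the ramp has slope 1.  Only this
history enters the bound, whence the condition a + h <= s: a barrier for times
after b has to start before b, and so do the exponentials below. *)
Lemma convol_ramp_increment a h s t : 0 < h <= H -> a + h <= s -> s <= t ->
  (t - s) * h `^ (1 - alpha) <= convol k (ramp a) t - convol k (ramp a) s.
Proof.
move=> hH ahs st; apply: convol_increment_ge => //.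
- exact: continuous_ramp.
- exact: ramp_homo.
- by rewrite subr_ge0.
- by move=> x xh; rewrite !rampE; lra.
Qed.

Lemma continuous_expR_ramp a m : continuous (fun s => expR (m * ramp a s)).
Proof.
move=> s; apply: continuous_comp; last exact: continuous_expR.
by apply: cvgM; [exact: cvg_cst|exact: continuous_ramp].
Qed.

Lemma expR_increment (p q : R) : expR q * (p - q) <= expR p - expR q.
Proof.
have := expR_ge1Dx (p - q); rewrite expRB ler_pdivlMr ?expR_gt0 //; lra.
Qed.

(** Over the last d units of time before s, the exponential is at least its value
at s divided by exp (m d). *)
Lemma convol_expR_growth a m d s t : 0 <= m -> 0 < d <= H -> a + d <= s -> s <= t ->
  m * (t - s) * expR (m * ramp a s - m * d) * d `^ (1 - alpha) <=
  convol k (fun r => expR (m * ramp a r)) t -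
  convol k (fun r => expR (m * ramp a r)) s.
Proof.
move=> m0 dH ads st; apply: convol_increment_ge => //.
- exact: continuous_expR_ramp.
- by move=> x y xy; rewrite ler_expR ler_wpM2l // ramp_homo.
- by rewrite !mulr_ge0 ?expR_ge0 ?subr_ge0.
- move=> x xd; apply: le_trans (expR_increment _ _).
  rewrite !rampE; try lra.
  have -> : m * (t - x - a) - m * (s - x - a) = m * (t - s) by ring.
  rewrite mulrC ler_wpM2r ?mulr_ge0 ?subr_ge0 // ler_expR.
  have : 0 <= m * (d - x) by rewrite mulr_ge0 //; lra.
  lra.
Qed.

Lemma convol_expR_decay a m d s t : 0 <= m -> 0 < d <= H -> a + d <= s -> s <= t ->
  m * (t - s) * expR (- m * ramp a t) * d `^ (1 - alpha) <=
  convol k (fun r => expR (- m * ramp a r)) s -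
  convol k (fun r => expR (- m * ramp a r)) t.
Proof.
move=> m0 dH ads st; set w := fun r => expR (- m * ramp a r).
have cw : continuous w by exact: continuous_expR_ramp.
have cN : continuous (fun r => - w r) by move=> r; apply: cvgN; exact: cw.
have wa x y : x <= y -> w y <= w x.
  by move=> xy; rewrite ler_expR ler_wnM2l ?oppr_le0 // ramp_homo.
have -> : convol k w s - convol k w t =
  convol k (fun r => - w r) t - convol k (fun r => - w r) s.
  by rewrite !(convolN a1 H0) //; ring.
apply: convol_increment_ge => //.
- by move=> x y xy; rewrite lerN2 wa.
- by rewrite !mulr_ge0 ?expR_ge0 ?subr_ge0.
- move=> x xd; rewrite opprK [leRHS]addrC; apply: le_trans (expR_increment _ _).
  rewrite !rampE; try lra.
  have -> : - m * (s - x - a) - - m * (t - x - a) = m * (t - s) by ring.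
  rewrite mulrC ler_wpM2r ?mulr_ge0 ?subr_ge0 // ler_expR.
  have : 0 <= m * x by rewrite mulr_ge0 //; lra.
  lra.
Qed.

Lemma continuous_scaled c v : continuous v -> continuous (fun s => c * v s).
Proof. by move=> cv s; apply: cvgM; [exact: cvg_cst|exact: cv]. Qed.

(** An integrated form of |D z| <= c |z| on ]b, T[, where D is the derivative of
k * z. *)
Definition memory_growth z b T c := forall s t m, b < s -> s <= t -> t < T ->
  (forall r, s <= r <= t -> `|z r| <= m) ->
  `|convol k z t - convol k z s| <= c * m * (t - s).

Lemma memory_growthN z b T c : continuous z -> memory_growth z b T c ->
  memory_growth (fun s => - z s) b T c.
Proof.
move=> cz zg s t m bs st tT zm.
rewrite !(convolN a1 H0) // -opprD normrN; apply: zg => // r /zm.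
by rewrite normrN.
Qed.

(** At a contact point p of z and phi, continuity keeps |z| below 2 |phi p| and
|phi| above |phi p| / 2 for a while.  The factor 4 in the decrease of k * phi
absorbs both factors 2, so k * (z - phi) is nondecreasing there. *)
Theorem barrier_comparison z phi b T c :
  continuous z -> continuous phi -> 0 <= c -> memory_growth z b T c ->
  (forall s t, b <= s -> s <= t ->
     4 * c * (t - s) * Num.min `|phi s| `|phi t| <=
     convol k phi s - convol k phi t) ->
  (forall s, phi s != 0) -> (forall s, s <= b -> phi s < z s) ->
  forall t, t <= T -> phi t <= z t.
Proof.
move=> cz cphi c0 Hz Hphi phi0 init t tT.
pose v s := z s - phi s.
have cv : continuous v by move=> s; apply: cvgB; [exact: cz|exact: cphi].
suff : 0 <= v t by rewrite /v subr_ge0.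
apply: (@comparison _ _ _ a0 a1 H0 v b T cv _ _ t tT) => [s sb|p /andP[bp pT] vp vle].
  by rewrite /v subr_ge0 ltW // init.
have zp : z p = phi p by apply/eqP; move/eqP: vp; rewrite /v subr_eq0.
have {}bp : b < p.
  rewrite lt_neqAle bp andbT; apply/eqP => bE.
  by have := init p; rewrite -bE lexx bE zp ltxx => /(_ isT).
pose P := `|phi p|.
have P0 : 0 < P by rewrite normr_gt0.
have nphi : \forall s \near p, P / 2 < `|phi s|.
  apply: cvgr_gt (cvg_norm (cphi p)) _ _; rewrite -/P; lra.
have nz : \forall s \near p, `|z s| < 2 * P.
  apply: cvgr_lt (cvg_norm (cz p)) _ _; rewrite zp -/P; lra.
have /nbhs_ballP[e /= e0 He] :
    \forall s \near p, P / 2 < `|phi s| /\ `|z s| < 2 * P by exact: filterI nphi nz.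
pose d := Num.min (e / 2) ((T - p) / 2).
have d0 : 0 < d by rewrite lt_min !divr_gt0 // subr_gt0.
have de : d < e by rewrite gt_min ltr_pdivrMr // ltr_pMr // ltr1n.
have dT : d < T - p.
  by rewrite gt_min orbC ltr_pdivrMr // ltr_pMr ?ltr1n // subr_gt0.
exists d => // s r ps sr rd.
have near_ x : p <= x -> x <= p + d ->
    P / 2 < `|phi x| /\ `|z x| < 2 * P.
  by move=> px xd; apply: He; rewrite /ball /= distrC ger0_norm; lra.
have zm : `|convol k z r - convol k z s| <= c * (2 * P) * (r - s).
  apply: Hz => //; [lra|lra|].
  by move=> x /andP[sx xr]; apply: ltW; apply: (near_ x _ _).2; lra.
have := Hphi s r (ltW (lt_le_trans bp ps)) sr.
have : P / 2 <= Num.min `|phi s| `|phi r|.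
  by rewrite le_min !ltW //; apply: (near_ _ _ _).1; lra.
move=> Pmin Hp.
rewrite /v !(convolB a1 H0) //.
move: zm; rewrite ler_norml => /andP[zm _].
have : 4 * c * (r - s) * (P / 2) <= convol k phi s - convol k phi r.
  by apply: le_trans Hp; rewrite ler_wpM2l // !mulr_ge0 // subr_ge0.
lra.
Qed.

(** If gap > eps, then z stays above a small positive multiple of a decaying
exponential, up to T, where it vanishes. *)
Lemma initial_value_le z a b T c gap eps : continuous z -> 0 <= c -> 1 <= H ->
  a + 1 <= b -> b < T -> 0 <= eps -> memory_growth z b T c ->
  (forall s, s <= b -> `|z s - gap| <= eps) -> z T = 0 -> gap <= eps.
Proof.
move=> cz c0 H1 ab bT eps0 zg zb zT; rewrite leNgt; apply/negP => gapeps.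
pose kappa := (gap - eps) / 2.
have kappa0 : 0 < kappa by rewrite divr_gt0 // subr_gt0.
pose w s := expR (- (4 * c) * ramp a s).
have cw : continuous w by exact: continuous_expR_ramp.
have w0 s : 0 < w s by exact: expR_gt0.
have w1 s : w s <= 1.
  by rewrite expR_le1 mulNr oppr_le0 !mulr_ge0 // ramp_ge0.
have : kappa * w T <= z T.
  apply: (@barrier_comparison z (fun s => kappa * w s) b T c) => //.
  - exact: continuous_scaled.
  - move=> s t bs st; rewrite !(convolZ a1 H0) // -mulrBr.
    apply: (@le_trans _ _
      (kappa * (4 * c * (t - s) * w t * 1 `^ (1 - alpha)))); last first.
      rewrite ler_wpM2l ?(ltW kappa0) //.
      by apply: convol_expR_decay => //; rewrite ?ltr01 ?mulr_ge0 //; lra.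
    rewrite powR1 mulr1 [leRHS]mulrCA ler_wpM2l //.
      by rewrite !mulr_ge0 // subr_ge0.
    by rewrite ge_min (gtr0_norm (mulr_gt0 kappa0 (w0 t))) lexx orbT.
  - by move=> s; rewrite mulf_neq0 // gt_eqF.
  - move=> s sb; have := zb s sb; rewrite ler_norml => /andP[zl _].
    have : kappa * w s <= kappa by rewrite ler_piMr // ltW.
    rewrite /kappa in kappa0 *; lra.
by rewrite zT leNgt mulr_gt0.
Qed.

Lemma small_step c : 0 <= c ->
  exists2 d : R, 0 < d <= 1 & 4 * c * expR 1 <= d `^ (- alpha).
Proof.
move=> c0; pose A := 4 * c * expR 1 + 1.
have Age1 : 1 <= A by rewrite lerDr !mulr_ge0 ?expR_ge0.
have A0 : 0 < A by exact: lt_le_trans Age1.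
exists (A `^ (- alpha^-1)).
  rewrite powR_gt0 //= powRN invf_le1 ?powR_gt0 //.
  by rewrite -(powRr0 A) ler_powR // invr_ge0 ltW.
rewrite -powRrM mulrN mulNr opprK mulVf ?gt_eqF // powRr1 ?(ltW A0) //.
by rewrite /A lerDl.
Qed.

(** The rate of the exponential is m = 1 / d: over the last d units of time it
loses a factor e only, while the kernel has mass of order d^(1 - alpha) there,
so that the increments of its convolution are of order m^alpha. *)
Lemma memory_growth_gronwall a c : 0 <= c -> 1 <= H ->
  exists2 m, 0 <= m & forall z b T delta, continuous z ->
  a + 1 <= b -> b < T -> 0 <= delta -> memory_growth z b T c ->
  (forall s, s <= b -> `|z s| <= delta) ->
  forall t, t <= T -> `|z t| <= delta * expR (m * ramp a t).
Proof.
move=> c0 H1; have [d /andP[d0 d1] dc] := small_step c0.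
exists d^-1; first by rewrite invr_ge0 ltW.
set m := d^-1; have m0 : 0 < m by rewrite invr_gt0.
move=> z b T delta cz ab bT delta0 zg zb t tT.
pose W s := expR (m * ramp a s).
have cW : continuous W by exact: continuous_expR_ramp.
have W0 s : 0 < W s by exact: expR_gt0.
have W1 s : 1 <= W s by rewrite -expR0 ler_expR mulr_ge0 ?ramp_ge0 // ltW.
(* The barrier must be strictly below at first, hence D > delta. *)
have half z' D : continuous z' -> memory_growth z' b T c ->
    (forall s, s <= b -> `|z' s| <= delta) -> delta < D -> - (D * W t) <= z' t.
  move=> cz' zg' zb' dD; have D0 : 0 < D by exact: le_lt_trans dD.
  rewrite -mulNr.
  apply: (@barrier_comparison z' (fun s => - D * W s) b T c) => //.
  - exact: continuous_scaled.
  - move=> r s br rs; rewrite !(convolZ a1 H0) //.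
    rewrite [leRHS](_ : _ = D * (convol k W s - convol k W r)); last by ring.
    apply: (@le_trans _ _ (D * (m * (s - r) * expR (m * ramp a r - m * d) *
      d `^ (1 - alpha)))); last first.
      rewrite ler_wpM2l ?(ltW D0) //.
      by apply: convol_expR_growth => //; rewrite ?(ltW m0) ?d0 //=; lra.
    have -> : m * (s - r) * expR (m * ramp a r - m * d) * d `^ (1 - alpha) =
        (s - r) * W r * ((d^-1 * d `^ (1 - alpha)) * expR (- 1)).
      by rewrite /m mulVf ?gt_eqF // expRD; rewrite /W /m; ring.
    have -> : d^-1 * d `^ (1 - alpha) = d `^ (- alpha).
      rewrite -powR_inv1 ?(ltW d0) // -powRD ?(gt_eqF d0) ?implybT //.
      by congr (_ `^ _); ring.
    have dc' : 4 * c <= d `^ (- alpha) * expR (-1).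
      by rewrite expRN ler_pdivlMr ?expR_gt0.
    apply: (@le_trans _ _ (D * W r * (s - r) * (4 * c))).
      have -> : D * W r * (s - r) * (4 * c) = 4 * c * (s - r) * (D * W r) by ring.
      rewrite ler_wpM2l ?mulr_ge0 ?subr_ge0 //.
      by rewrite ge_min mulNr normrN (gtr0_norm (mulr_gt0 D0 (W0 r))) lexx.
    rewrite -!mulrA ler_wpM2l ?(ltW D0) //.
    rewrite [leRHS]mulrCA ler_wpM2l ?(ltW (W0 _)) //.
    by rewrite ler_wpM2l // subr_ge0.
  - by move=> s; rewrite mulf_neq0 // ?oppr_eq0 gt_eqF.
  - move=> s sb; have := zb' s sb; rewrite ler_norml => /andP[zl _].
    have : D <= D * W s by rewrite ler_peMr // ltW.
    lra.
apply/ler_addgt0Pr => e e0.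
have e' : 0 < e / W t by rewrite divr_gt0.
have dD : delta < delta + e / W t by rewrite ltrDl.
have -> : delta * expR (m * ramp a t) + e = (delta + e / W t) * W t.
  by rewrite mulrDl divfK // gt_eqF.
rewrite ler_norml half //=.
have czN : continuous (fun s => - z s) by move=> s; apply: cvgN; exact: cz.
have := @half (fun s => - z s) _ czN (memory_growthN cz zg) _ dD.
by rewrite lerN2; apply => s /zb; rewrite normrN.
Qed.

End Barriers.

(** * Solutions of terminal value problems *)

Section Solutions.
Context {R : realType}.
Variables (alpha H : R).
Hypotheses (a0 : 0 < alpha) (a1 : alpha < 1) (H0 : 0 < H).
Implicit Types (y : R -> R) (f : R * R -> R).
Implicit Types (a b T s t h M ystar L : R).

Local Notation k := (pker alpha H).
Local Notation G := (Gamma (1 - alpha)).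

Lemma convol_increment_caputo y b T s t : b < T -> T - b <= H ->
  {within `[b, T], continuous y} -> b <= s <= T -> b <= t <= T ->
  convol k (clamp b T y) t - convol k (clamp b T y) s =
  G * (caputo_primitive alpha b y t - caputo_primitive alpha b y s).
Proof.
move=> bT TbH cy bsT btT; have G0 := Gamma_gt0 a0 a1.
rewrite !(caputo_primitive_convol a0 a1 H0 bT TbH cy) //.
rewrite -mulrBr mulrA divff ?gt_eqF // mul1r; ring.
Qed.

Lemma solution_is_derive f ystar y b T t : is_tvp_solution alpha b T f ystar y ->
  b < t < T -> is_derive t 1 (caputo_primitive alpha b y) (f (t, y t)).
Proof.
move=> [_ ysol _] btT; have /andP[bt tT] := btT.
have [dy <-] := ysol t ltac:(by rewrite in_itv /= bt ltW).
exact: derive_within_interior.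
Qed.

Lemma solution_continuous f ystar y b T : b < T ->
  is_tvp_solution alpha b T f ystar y -> continuous (clamp b T y).
Proof. by move=> bT [cy _ _]; exact: continuous_clamp. Qed.

(** The barrier is a ramp that starts at a - h, with slope a multiple of
h^(alpha - 1): its convolution then has increments at least G * M * (t - s) after
a, and it is at most of order h^alpha until a + h. *)
Lemma solution_holder f ystar y a T M h : a < T -> T - a <= H -> 0 < M ->
  0 < h <= H -> (forall t x, a <= t <= T -> `|f (t, x)| <= M) ->
  is_tvp_solution alpha a T f ystar y ->
  forall s, s <= T -> s <= a + h ->
    `|clamp a T y s - y a| <= 2 * (G * M) * h `^ alpha.
Proof.
move=> aT TaH M0 /andP[h0 hH] fM sol s1 s1T s1h.
have cw := solution_continuous aT sol; have [cy _ _] := sol.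
have G0 := Gamma_gt0 a0 a1; have GM0 : 0 < G * M by rewrite mulr_gt0.
have hh : h `^ (alpha - 1) * h `^ (1 - alpha) = 1.
  rewrite -powRD; last by rewrite (gt_eqF h0) implybT.
  by have -> : alpha - 1 + (1 - alpha) = 0 by [ring]; rewrite powRr0.
have hha : h `^ (alpha - 1) * h = h `^ alpha by rewrite mulrC mulr_powRB1 ?(ltW h0).
pose A := G * M * h `^ (alpha - 1).
have A0 : 0 < A by rewrite mulr_gt0 ?powR_gt0.
have crA c : continuous (fun s => c + A * ramp (a - h) s).
  move=> s; apply: cvgD; first exact: cvg_cst.
  by apply: continuous_scaled; exact: continuous_ramp.
(* sg = 1 and sg = -1 give the two halves of the bound. *)
have side sg : `|sg| = 1 -> sg * (clamp a T y s1 - y a) <= A * ramp (a - h) s1.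
  move=> sg1.
  pose v s := - sg * - y a + A * ramp (a - h) s + - sg * clamp a T y s.
  suff : 0 <= v s1 by rewrite /v; lra.
  have cv : continuous v.
    by move=> s; apply: cvgD; [exact: crA|exact: continuous_scaled].
  have va s : s <= a -> v s = A * ramp (a - h) s.
    by move=> sa; rewrite /v (clamp_le _ (ltW aT) sa); ring.
  apply: (@comparison _ _ _ a0 a1 H0 v a T cv _ _ s1 s1T) => [s sa|p /andP[ap pT] vp _].
    by rewrite va // mulr_ge0 ?ramp_ge0 // ltW.
  have {}ap : a < p.
    rewrite lt_neqAle ap andbT; apply/eqP => aE.
    move: vp; rewrite -aE va // rampE; last lra.
    by apply/eqP; rewrite mulf_neq0 ?gt_eqF //; lra.
  exists ((T - p) / 2); first by rewrite divr_gt0 // subr_gt0.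
  move=> s t ps st tp.
  have incr : `|convol k (clamp a T y) t - convol k (clamp a T y) s| <= G * M * (t - s).
    rewrite convol_increment_caputo //; try (apply/andP; split; lra).
    rewrite normrM gtr0_norm // -mulrA ler_wpM2l ?(ltW G0) //.
    apply: (@increment_le _ _ (fun r => f (r, y r))) => // r /andP[sr rt].
      by apply: solution_is_derive sol _; apply/andP; split; lra.
    by apply: fM; apply/andP; split; lra.
  have rincr : (t - s) * h `^ (1 - alpha) <=
      convol k (ramp (a - h)) t - convol k (ramp (a - h)) s.
    by apply: convol_ramp_increment => //; rewrite ?h0 //; lra.
  have cr := @continuous_ramp R (a - h).
  have cc : continuous (fun _ : R => - sg * - y a) by move=> ?; exact: cvg_cst.
  have vE r : convol k v r = convol k (fun=> - sg * - y a) r +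
      A * convol k (ramp (a - h)) r + - sg * convol k (clamp a T y) r.
    by rewrite /v (convol_linear a1 H0) // (convol_linear a1 H0).
  have cE : convol k (fun=> - sg * - y a) s = convol k (fun=> - sg * - y a) t by [].
  rewrite !vE cE.
  have : sg * (convol k (clamp a T y) t - convol k (clamp a T y) s) <= G * M * (t - s).
    by apply: le_trans (ler_norm _) _; rewrite normrM sg1 mul1r.
  have : A * ((t - s) * h `^ (1 - alpha)) <=
      A * (convol k (ramp (a - h)) t - convol k (ramp (a - h)) s).
    by rewrite ler_wpM2l // ltW.
  have -> : A * ((t - s) * h `^ (1 - alpha)) = G * M * (t - s).
    by rewrite /A mulrCA -!mulrA hh mulr1; ring.
  lra.
have rs : A * ramp (a - h) s1 <= 2 * (G * M) * h `^ alpha.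
  have -> : 2 * (G * M) * h `^ alpha = A * (2 * h) by rewrite -hha /A; ring.
  rewrite ler_wpM2l ?(ltW A0) //.
  have [sah|sah] := leP s1 (a - h); first by rewrite ramp_le // mulr_ge0 // ltW.
  by rewrite rampE ?(ltW sah) //; lra.
apply: le_trans rs; rewrite ler_norml.
have := side 1 (normr1 _); rewrite mul1r => ->; rewrite andbT.
have := side (-1) (normrN1 _); rewrite mulN1r; lra.
Qed.

(** The difference of the two Caputo primitives has derivative
f (r, y r) - f (r, ytilde r) at every r in ]b, T[. *)
Lemma solution_difference_growth f ystar y ytilde a b T L :
  a <= b -> b < T -> T - a <= H -> 0 <= L ->
  (forall t u v : R, t \in `[a, T] -> `|f (t, u) - f (t, v)| <= L * `|u - v|) ->
  is_tvp_solution alpha a T f ystar y -> is_tvp_solution alpha b T f ystar ytilde ->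
  memory_growth alpha H (fun s => clamp a T y s - clamp b T ytilde s) b T (G * L).
Proof.
move=> ab bT TaH L0 fL sy syt s t m bs st tT zm.
have aT : a < T by exact: le_lt_trans bT.
have [cy _ _] := sy; have [cyt _ _] := syt.
have cw := solution_continuous aT sy; have cwt := solution_continuous bT syt.
have G0 := Gamma_gt0 a0 a1.
have zE r : convol k (fun s => clamp a T y s - clamp b T ytilde s) r =
   convol k (clamp a T y) r - convol k (clamp b T ytilde) r.
  by rewrite (convolB a1 H0).
pose P r := caputo_primitive alpha a y r - caputo_primitive alpha b ytilde r.
have -> : convol k (fun s => clamp a T y s - clamp b T ytilde s) t -
    convol k (fun s => clamp a T y s - clamp b T ytilde s) s = G * (P t - P s).
  have -> : G * (P t - P s) =
    G * (caputo_primitive alpha a y t - caputo_primitive alpha a y s) -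
    G * (caputo_primitive alpha b ytilde t - caputo_primitive alpha b ytilde s).
    by rewrite /P; ring.
  rewrite -(@convol_increment_caputo y a T) ?zE //; try lra.
  rewrite -(@convol_increment_caputo ytilde b T) //; try lra.
rewrite normrM gtr0_norm // -!mulrA ler_wpM2l ?(ltW G0) // mulrA.
apply: (@increment_le _ P (fun r => f (r, y r) - f (r, ytilde r))) => // r /andP[sr rt].
  apply: is_deriveB; first by apply: solution_is_derive sy _; lra.
  by apply: solution_is_derive syt _; lra.
apply: le_trans (fL _ _ _ _) _; first by rewrite in_itv /=; lra.
rewrite ler_wpM2l //.
have : `|clamp a T y r - clamp b T ytilde r| <= m by apply: zm; rewrite sr.
by rewrite !clamp_in //; lra.
Qed.

End Solutions.

Theorem theorem3p2 (R : realType) (alpha a T ystar : R) (f : R * R -> R) (L : R)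
    (alpha_gt0 : 0 < alpha) (alpha_lt1 : alpha < 1) (aT : a < T)
    (f_continuous : {within `[a, T] `*` setT, continuous f})
    (f_bounded : [bounded f p | p in `[a, T] `*` setT])
    (L_ge0 : 0 <= L)
    (f_lipschitz : forall t u v : R, t \in `[a, T] ->
       `|f (t, u) - f (t, v)| <= L * `|u - v|) :
  exists C : R, forall (y : R -> R), is_tvp_solution alpha a T f ystar y ->
    forall (b : R) (ytilde : R -> R), a <= b -> b < T ->
      is_tvp_solution alpha b T f ystar ytilde ->
      (ereal_sup [set (`|y t - ytilde t|)%:E | t in `[b, T]]
         <= (C * `|a - b| `^ alpha)%:E)%E.
Proof.
have [M M0 fM] : exists2 M, 0 < M & forall t x, a <= t <= T -> `|f (t, x)| <= M.
  have [N [_ fN]] := f_bounded.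
  exists (Num.max 1 (N + 1)); first by rewrite lt_max ltr01.
  move=> t x atT; apply: fN; first by rewrite lt_max ltrDl ltr01 orbT.
  by split => //=; rewrite in_itv.
pose G := Gamma (1 - alpha); have G0 : 0 < G by exact: Gamma_gt0.
have GL0 : 0 <= G * L by rewrite mulr_ge0 // ltW.
(* One unit more than T - a, because the exponential barriers start at a - 1. *)
pose H := T - a + 1; have H1 : 1 <= H by rewrite /H; lra.
have H0 : 0 < H by exact: lt_le_trans H1.
have [m m0 gronwall] := memory_growth_gronwall alpha_gt0 alpha_lt1 H0 (a - 1) GL0 H1.
exists (4 * (G * M) * expR (m * (T - a + 1))).
move=> y sy b ytilde ab bT syt.
pose z s := clamp a T y s - clamp b T ytilde s.
pose gap := y a - ytilde b.
pose eps := 2 * (G * M) * `|a - b| `^ alpha.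
have eps0 : 0 <= eps by rewrite !mulr_ge0 ?powR_ge0 // ltW.
have cw := solution_continuous aT sy; have cwt := solution_continuous bT syt.
have cz : continuous z by move=> s; apply: cvgB; [exact: cw|exact: cwt].
have cNz : continuous (fun s => - z s) by move=> s; apply: cvgN; exact: cz.
have zg : memory_growth alpha H z b T (G * L).
  apply: solution_difference_growth sy syt => //; rewrite /H; lra.
have Nzg := memory_growthN alpha_lt1 H0 cz zg.
have z_init s : s <= b -> `|z s - gap| <= eps.
  move=> sb; rewrite /z (clamp_le _ (ltW bT) sb) /gap.
  have -> : clamp a T y s - ytilde b - (y a - ytilde b) = clamp a T y s - y a by ring.
  have [sa|sa] := leP s a; first by rewrite (clamp_le _ (ltW aT) sa) subrr normr0.
  have hab : `|a - b| = b - a by rewrite distrC ger0_norm // subr_ge0.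
  rewrite /eps hab.
  apply: (solution_holder alpha_gt0 alpha_lt1 H0 aT _ M0 _ fM sy); rewrite /H; lra.
have zT : z T = 0.
  have [_ _ yT] := sy; have [_ _ ytT] := syt.
  by rewrite /z !clamp_in ?yT ?ytT ?subrr ?lexx ?ltW.
have ab1 : a - 1 + 1 <= b by rewrite subrK.
have gap_le : `|gap| <= eps.
  rewrite ler_norml lerNl; apply/andP; split.
    apply: (initial_value_le alpha_gt0 alpha_lt1 H0 cNz GL0 H1 ab1 bT eps0 Nzg).
      by move=> s /z_init; rewrite -opprD normrN.
    by rewrite zT oppr0.
  exact: (initial_value_le alpha_gt0 alpha_lt1 H0 cz GL0 H1 ab1 bT eps0 zg).
have eps2 : 0 <= 2 * eps by rewrite mulr_ge0.
have z2 s : s <= b -> `|z s| <= 2 * eps.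
  move=> /z_init zs; have -> : z s = (z s - gap) + gap by ring.
  by apply: le_trans (ler_normD _ _) _; lra.
apply: ge_ereal_sup => _ [t /= tbT <-]; rewrite lee_fin.
move: tbT; rewrite in_itv /= => /andP[bt tT].
have -> : y t - ytilde t = z t by rewrite /z !clamp_in //; lra.
apply: le_trans (gronwall z b T _ cz ab1 bT eps2 zg z2 t tT) _.
have -> : 4 * (G * M) * expR (m * (T - a + 1)) * `|a - b| `^ alpha =
  2 * eps * expR (m * (T - a + 1)) by rewrite /eps; ring.
rewrite ler_wpM2l // ler_expR ler_wpM2l // rampE; lra.
Qed.
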